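(* Let $\mathbf{v}_1,\ldots,\mathbf{v}_n\in\mathbb{C}^d$ and $\tau_1,\ldots,\tau_n>0$ satisfy $\sum_{i=1}^n\tau_i^2(\mathbf{v}_i\mathbf{v}_i^* )^2\preceq\mathbf{I}$. Define the univariate polynomial $$p_\emptyset(x)=\prod_{i=1}^n\Big(1-\frac12\partial_{z_i}^2\Big)\Big|_{z_i=0}\det\Big[x\mathbf{I}+\sum_{i=1}^n z_i\tau_i\mathbf{v}_i\mathbf{v}_i^*\Big]^2,$$ i.e. apply the operators $1-\frac12\partial_{z_i}^2$ for all $i$ to the polynomial in $(x,z_1,\ldots,z_n)$ and then set $z_1=\cdots=z_n=0$. Then the largest root of $p_\emptyset$ is at most $3$.
   Context: $\preceq$ denotes the Loewner order on Hermitian matrices. *)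

(* Defs.v *)
From HB Require Import structures.
From mathcomp Require Import all_boot all_order all_algebra.
From mathcomp Require Import mpoly.
Set Implicit Arguments. Unset Strict Implicit. Unset Printing Implicit Defensive.
Import Order.TTheory GRing.Theory Num.Theory.
Local Open Scope ring_scope.

Definition adjmx (C : numClosedFieldType) m k (A : 'M[C]_(m, k)) : 'M[C]_(k, m) :=
  (map_mx Num.conj A)^T.

(* Positive semidefinite: u^* A u >= 0 for all u (in C, 0 <= z means z real, z >= 0). *)
Definition psdmx (C : numClosedFieldType) d (A : 'M[C]_d) : Prop :=
  forall u : 'cV[C]_d, 0 <= (adjmx u *m A *m u) 0 0.

Definition loewner_le (C : numClosedFieldType) d (A B : 'M[C]_d) : Prop :=
  psdmx (B - A).

Definition outer (C : numClosedFieldType) d (v : 'cV[C]_d) : 'M[C]_d :=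
  v *m adjmx v.

(* The polynomial det[x I + sum_i z_i tau_i v_i v_i^*]^2, as a polynomial in
   z_1..z_n (mpoly variables 'X_i) with coefficients in C[x] (x = 'X of {poly C}). *)
Definition detsq (C : numClosedFieldType) d n (tau : 'I_n -> C)
  (v : 'I_n -> 'cV[C]_d) : {mpoly {poly C}[n]} :=
  (\det (\matrix_(a < d, b < d)
      (('X * (a == b)%:R)%:MP
       + \sum_(i < n) 'X_i * ((tau i * (outer (v i)) a b)%:P)%:MP))) ^+ 2.

Definition op_i (C : numClosedFieldType) n (i : 'I_n) (q : {mpoly {poly C}[n]}) :
  {mpoly {poly C}[n]} :=
  q - ((2%:R^-1 : C)%:P)%:MP * mderiv i (mderiv i q).

Definition p_empty (C : numClosedFieldType) d n (tau : 'I_n -> C)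
  (v : 'I_n -> 'cV[C]_d) : {poly C} :=
  (foldr (@op_i C n) (detsq tau v) (enum 'I_n)).@[fun _ => 0].

(* Main.v *)
(** Fix [x > 3] and let [P = det (x I + sum_i z_i A_i)] with [A_i = tau_i v_i v_i^*]
    and [kappa_i = tau_i |v_i|^2].  A barrier argument is run on [P^2], adding
    [kappa_i] to the coordinate [z_i] when the operator [1 - d_i^2 / 2] is applied,
    starting from the orthant [z_i >= - kappa_i] and ending at [z = 0].  The invariant
    is that the current polynomial [p] is real stable, quadratic in every variable,
    positive on the orthant and satisfies [(x - 1) d_j p <= 2 kappa_j p] there for the
    unprocessed [j].

    Stability gives the Rayleigh inequalities [p d_i d_j p <= d_i p d_j p] at real
    points.  Along a line in direction [i], put [p = A + B t + C t^2] and
    [d_j p = A' + B' t + C' t^2].  With [N0 = A'B - AB'], [N1 = A'C - AC'],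
    [N2 = B'C - BC'] these inequalities say [N0 + 2 N1 t + N2 t^2 >= 0] for all
    [t]; together with the Pluecker relation [A N2 - B N1 + C N0 = 0] this yields
    [A N1 <= B N0], which is exactly what the invariant needs in order to survive
    the replacement of [A] by [A + B kappa + C (kappa^2 - 1)].  The step only needs
    a shift [c kappa_i] and a bound [s d_j p <= 2 kappa_j p] with [c s >= 2]; the
    constant 3 is [c + s] for [c = 1] and [s = 2]. *)
Require Import Defs.
From HB Require Import structures.
From mathcomp Require Import all_boot all_order all_algebra.
From mathcomp Require Import mpoly.
From mathcomp Require Import ring lra.
Import Order.TTheory GRing.Theory Num.Theory.
Set Implicit Arguments. Unset Strict Implicit. Unset Printing Implicit Defensive.
Local Open Scope ring_scope.

(** * The ordered field of real elements *)

(* [lra] and [nra] need a totally ordered field, which [C] is not. *)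
Record realpart (C : numClosedFieldType) :=
  RealPart { rval :> C; rvalP : rval \is Num.real }.
Section RealPart.
Context (C : numClosedFieldType).
HB.instance Definition _ := [isSub for (@rval C)].
HB.instance Definition _ := [Choice of realpart C by <:].
HB.instance Definition _ := [SubChoice_isSubComUnitRing of realpart C by <:].
HB.instance Definition _ := [SubComUnitRing_isSubIntegralDomain of realpart C by <:].
HB.instance Definition _ := [SubIntegralDomain_isSubField of realpart C by <:].
Implicit Types x y : realpart C.
Definition realpart_le x y := rval x <= rval y.
Definition realpart_lt x y := rval x < rval y.
Definition realpart_norm x : realpart C := RealPart (normr_real (rval x)).
Fact realpart_le0_add x y : realpart_le 0 x -> realpart_le 0 y -> realpart_le 0 (x + y).
Proof. exact: addr_ge0. Qed.
Fact realpart_le0_mul x y : realpart_le 0 x -> realpart_le 0 y -> realpart_le 0 (x * y).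
Proof. exact: mulr_ge0. Qed.
Fact realpart_le0_anti x : realpart_le 0 x -> realpart_le x 0 -> x = 0.
Proof. by move=> h1 h2; apply/val_inj/le_anti/andP; split. Qed.
Fact realpart_sub_ge0 x y : realpart_le 0 (y - x) = realpart_le x y.
Proof. exact: subr_ge0. Qed.
Fact realpart_le0_total x : realpart_le 0 x || realpart_le x 0.
Proof. exact: rvalP. Qed.
Fact realpart_normN x : realpart_norm (- x) = realpart_norm x.
Proof. apply: val_inj; exact: normrN. Qed.
Fact realpart_ge0_norm x : realpart_le 0 x -> realpart_norm x = x.
Proof. by move=> h; apply/val_inj/ger0_norm. Qed.
Fact realpart_lt_def x y : realpart_lt x y = (y != x) && realpart_le x y.
Proof. exact: lt_def. Qed.
HB.instance Definition _ := Num.IntegralDomain_isLeReal.Build (realpart C)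
  realpart_le0_add realpart_le0_mul realpart_le0_anti realpart_sub_ge0
  realpart_le0_total realpart_normN
  realpart_ge0_norm realpart_lt_def.
End RealPart.

Lemma realpartP (C : numClosedFieldType) (x : C) :
  x \is Num.real -> exists y : realpart C, x = rval y.
Proof. by move=> xr; exists (RealPart xr). Qed.

(** * Real inequalities for one barrier step *)

Section Ineq.
Context (R : realFieldType).
Implicit Types A B C : R.

(** Replaces letting [s] tend to 0: a positive [K] is refuted at [s = K / (2 (M + K + 1))]. *)
Lemma le0_of_le_small (K M : R) : 0 <= M ->
  (forall s, 0 < s -> s <= 1 -> K <= s * M) -> K <= 0.
Proof.
move=> M0 H; rewrite leNgt; apply/negP => K0.
have M1 : 0 < M + K + 1 by lra.
pose s := K / (2 * (M + K + 1)).
have E : s * (2 * (M + K + 1)) = K by rewrite /s; field; lra.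
have s0 : 0 < s by rewrite /s divr_gt0 //; lra.
have s1 : s <= 1 by nra.
have := H s s0 s1; nra.
Qed.

(** The first hypothesis is the Rayleigh inequality with both indices equal, the second is
    positivity on a half-line of the orthant. A negative coefficient would produce a point [t >= 0]
    violating one of them. *)
Lemma quad_coef_ge0 A B C :
  (forall t, (A + B * t + C * t ^+ 2) * (2 * C) <= (B + 2 * C * t) ^+ 2) ->
  (forall t, 0 <= t -> 0 < A + B * t + C * t ^+ 2) ->
  0 <= B /\ 0 <= C.
Proof.
move=> Hd Hp.
have A0 : 0 < A by have := Hp 0 (lexx _); rewrite mulr0 expr0n /= mulr0 !addr0.
have C0 : 0 <= C.
  rewrite leNgt; apply/negP => C0.
  (* Here [t >= 1] and [B + C t = B - |B| - A + C <= C - A < 0], so the value at [t] is at most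
     [C < 0]. *)
  pose t := (A + `|B| - C) / (- C).
  have nB := ler_norm B; have nB0 := normr_ge0 B.
  have E : t * (- C) = A + `|B| - C by rewrite /t; field; lra.
  have t1 : 1 <= t by nra.
  have t0 : 0 <= t by lra.
  have := Hp t t0.
  have -> : A + B * t + C * t ^+ 2 = A + t * (B - t * (- C)) by ring.
  rewrite E; nra.
split=> //; rewrite leNgt; apply/negP => B0.
have [C1|C1] := eqVneq C 0.
  have := Hp (A / (- B)) _; have t0 : 0 <= A / - B by rewrite divr_ge0; lra.
  move=> /(_ t0); rewrite C1 mul0r addr0.
  have -> : A + B * (A / - B) = 0 by field; lra.
  by rewrite ltxx.
have C2 : 0 < C by rewrite lt_def C1.
(* At the vertex the right side of the discriminant inequality vanishes while its left side is
   positive. *)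
pose t := - B / (2 * C).
have t0 : 0 <= t by rewrite /t divr_ge0; lra.
have E : 2 * C * t = - B by rewrite /t; field.
have := Hd t; have := Hp t t0; rewrite E addrN expr0n /=; nra.
Qed.

(** [A + B t + C t^2] and its primed analogue are [p] and [d_j p] along direction [i]. Since
    [d_i^2 / 2] contributes the constant [C], the operator evaluated at [t = k] gives
    [A + B k + C (k^2 - 1)]. *)
Lemma barrier_step (A B C A' B' C' k s m : R) :
  2 < s -> 0 <= k -> 0 < A -> 0 <= B -> 0 <= C ->
  A * (2 * C) <= B ^+ 2 -> s * B <= 2 * k * A ->
  (forall t, (A + B * t + C * t ^+ 2) * (B' + 2 * C' * t) <=
             (B + 2 * C * t) * (A' + B' * t + C' * t ^+ 2)) ->
  s * A' <= m * A ->
  0 < A + B * k + C * (k ^+ 2 - 1) /\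
  s * (A' + B' * k + C' * (k ^+ 2 - 1)) <=
     m * (A + B * k + C * (k ^+ 2 - 1)).
Proof.
move=> s2 k0 A0 B0 C0 HD HB HR HA.
have B1 : B <= k * A.
  have h : 0 <= (s - 2) * B by rewrite mulr_ge0 //; lra.
  clear -h HB; lra.
set P := A + B * k + C * (k ^+ 2 - 1).
have P0 : 0 < P.
  have Bk : 0 <= B * k by rewrite mulr_ge0.
  rewrite /P; have [k1|k1] := lerP 1 k.
    have h : 0 <= C * (k ^+ 2 - 1) by rewrite mulr_ge0 // subr_ge0 expr_ge1.
    clear -h Bk A0; lra.
  have k2 : k ^+ 2 <= 1 by rewrite expr_le1 // ltW.
  (* For [k < 1], [B <= k A <= A] and the discriminant bound give [2 C <= A], which absorbs the loss
     [- C]. *)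
  have B2 : B ^+ 2 <= A ^+ 2.
    rewrite lerXn2r ?nnegrE ?(ltW A0) //; apply: le_trans B1 _.
    by rewrite ger_pMl // ltW.
  have C1 : 2 * C <= A.
    by rewrite -(ler_pM2l A0) (le_trans HD) // -expr2.
  have h : 0 <= C * k ^+ 2 by rewrite mulr_ge0 ?sqr_ge0.
  clear -h C1 A0 Bk; lra.
split=> //.
pose N0 := A' * B - A * B'; pose N1 := A' * C - A * C'; pose N2 := B' * C - B * C'.
have HN t : 0 <= N0 + 2 * N1 * t + N2 * t ^+ 2.
  by have := HR t; rewrite -subr_ge0; congr (_ <= _); rewrite /N0 /N1 /N2; ring.
have PL : B * N1 = A * N2 + C * N0 by rewrite /N0 /N1 /N2; ring.
have N00 : 0 <= N0 by have := HN 0; rewrite mulr0 expr0n /= mulr0 !addr0.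
have N20 : 0 <= N2.
  rewrite leNgt; apply/negP => N2n.
  pose t := (N0 + 2 * `|N1| - N2) / (- N2).
  have nB := ler_norm N1; have nB0 := normr_ge0 N1.
  have E : t * (- N2) = N0 + 2 * `|N1| - N2 by rewrite /t; field; lra.
  have t1 : 1 <= t by nra.
  have := HN t.
  have -> : N0 + 2 * N1 * t + N2 * t ^+ 2 = N0 + t * (2 * N1 - t * (- N2)) by ring.
  rewrite E; nra.
(* Discriminant of the nonnegative quadratic [HN], read off at its vertex; if [N2 = 0], a nonzero
   slope would let it reach -1. *)
have D : N1 ^+ 2 <= N0 * N2.
  have [N2z|N2z] := eqVneq N2 0.
    have [->|N1z] := eqVneq N1 0; first by rewrite expr0n /= mulr_ge0.
    have := HN (- (N0 + 1) / (2 * N1)); rewrite N2z mul0r addr0.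
    have -> : N0 + 2 * N1 * (- (N0 + 1) / (2 * N1)) = -1 by field.
    lra.
  have N2p : 0 < N2 by rewrite lt_def N2z.
  have := HN (- N1 / N2).
  have -> : N0 + 2 * N1 * (- N1 / N2) + N2 * (- N1 / N2) ^+ 2
     = (N0 * N2 - N1 ^+ 2) / N2 by field.
  by rewrite pmulr_lge0 ?invr_gt0 // subr_ge0.
have N10 : 0 <= N1.
  have [Bz|Bz] := eqVneq B 0.
    have E : A * N2 = 0.
      have : 0 <= A * N2 by nra.
      have : 0 <= C * N0 by nra.
      by move: PL; rewrite Bz mul0r; lra.
    have {}E : N2 = 0 by move/eqP: E; rewrite mulf_eq0 => /orP[]/eqP //; lra.
    move: D; rewrite E mulr0 => D; suff -> : N1 = 0 by [].
    by apply/eqP; rewrite -sqrf_eq0 eq_le D sqr_ge0.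
  have Bp : 0 < B by rewrite lt_def Bz.
  by rewrite -(pmulr_rge0 _ Bp) PL; nra.
(* After multiplication by [N1]: [A N1^2 <= A N0 N2 = N0 (B N1 - C N0) <= B N0 N1]. *)
have AN : A * N1 <= B * N0.
  have [N0z|N0z] := eqVneq N0 0.
    suff -> : N1 = 0 by rewrite N0z !mulr0.
    move: D; rewrite N0z mul0r => D.
    by apply/eqP; rewrite -sqrf_eq0 eq_le D sqr_ge0.
  have [->|N1z] := eqVneq N1 0; first by rewrite mulr0; nra.
  have N0p : 0 < N0 by rewrite lt_def N0z.
  have N1p : 0 < N1 by rewrite lt_def N1z.
  have h : (A * N1) * N1 <= (B * N0) * N1.
    have : A * N1 ^+ 2 <= A * (N0 * N2) by rewrite ler_pM2l.
    have : 0 <= C * N0 ^+ 2 by rewrite mulr_ge0 // sqr_ge0.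
    have -> : (B * N0) * N1 = N0 * (A * N2 + C * N0) by rewrite -PL; ring.
    nra.
  by rewrite ler_pM2r in h.
(* This is the gain appearing in [E]. For [k < 1] it follows from [A N1 <= B N0 <= k A N0]. *)
have G : 0 <= k * N0 + (k ^+ 2 - 1) * N1.
  have [k1|k1] := lerP 1 k.
    by rewrite addr_ge0 ?mulr_ge0 // subr_ge0 expr_ge1.
  have h1 : N1 <= k * N0.
    rewrite -(ler_pM2l A0) (le_trans AN) //.
    have -> : A * (k * N0) = (k * A) * N0 by ring.
    by rewrite ler_wpM2r.
  have h2 : 0 <= k ^+ 2 * N1 by rewrite mulr_ge0 ?sqr_ge0.
  clear -h1 h2; lra.
have E : A * (A' + B' * k + C' * (k ^+ 2 - 1)) =
         A' * P - (k * N0 + (k ^+ 2 - 1) * N1).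
  by rewrite /P /N0 /N1; ring.
rewrite -(ler_pM2l A0).
have -> : A * (s * (A' + B' * k + C' * (k ^+ 2 - 1))) =
          s * (A * (A' + B' * k + C' * (k ^+ 2 - 1))) by ring.
rewrite E.
have -> : A * (m * P) = (m * A) * P by ring.
have h1 : (s * A') * P <= (m * A) * P by rewrite ler_pM2r.
have h2 : 0 <= s * (k * N0 + (k ^+ 2 - 1) * N1) by rewrite mulr_ge0 //; lra.
clear -h1 h2; lra.
Qed.
End Ineq.

(** * Multivariate polynomials along lines *)

(** Constants and variables generate the polynomial ring, so identities compatible with sums and
    products need checking only there. *)
Lemma mpoly_alg_ind n (R : comNzRingType) (P : {mpoly R[n]} -> Prop) :
  (forall c, P c%:MP) -> (forall i, P 'X_i) ->
  (forall p q, P p -> P q -> P (p + q)) ->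
  (forall p q, P p -> P q -> P (p * q)) -> forall p, P p.
Proof.
move=> PC PX PD PM; elim/mpolyind => [|c m p _ _ IH]; first by rewrite -mpolyC0.
apply: (PD) => //; rewrite -mul_mpolyC; apply: (PM) => //; rewrite mpolyXE_id.
have PXn i k : P ('X_i ^+ k).
  elim: k => [|k IHk]; first by rewrite expr0 -mpolyC1.
  by rewrite exprS; apply: (PM).
by apply: (big_ind P) => //; rewrite -mpolyC1.
Qed.

Lemma meval_map n (R S : comNzRingType) (g : {rmorphism R -> S}) (w : 'I_n -> R)
  (p : {mpoly R[n]}) : (map_mpoly g p).@[fun k => g (w k)] = g p.@[w].
Proof.
elim/mpoly_alg_ind: p => [c|i|p q Hp Hq|p q Hp Hq].
- by rewrite map_mpolyC !mevalC.
- by rewrite map_mpolyX !mevalXU.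
- by rewrite rmorphD !mevalD rmorphD Hp Hq.
- by rewrite rmorphM !mevalM rmorphM Hp Hq.
Qed.

Lemma map_mderiv n (R S : comNzRingType) (g : {rmorphism R -> S}) i
  (p : {mpoly R[n]}) : map_mpoly g (mderiv i p) = mderiv i (map_mpoly g p).
Proof.
apply/mpolyP => m; rewrite mcoeff_map_mpoly !mcoeff_deriv mcoeff_map_mpoly.
exact: raddfMn.
Qed.

(** The restriction [t -> p(z + t d)], kept as a univariate polynomial so that roots and derivatives
    are available. *)
Definition line n (R : comNzRingType) (z d : 'I_n -> R) (p : {mpoly R[n]}) : {poly R} :=
  mmap (@polyC R) (fun k => (z k)%:P + d k *: 'X) p.

Section Line.
Context (n : nat) (R : comNzRingType) (z d : 'I_n -> R).
Implicit Types p q : {mpoly R[n]}.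

Lemma lineC c : line z d c%:MP = c%:P. Proof. exact: mmapC. Qed.
Lemma lineX i : line z d 'X_i = (z i)%:P + d i *: 'X.
Proof. by rewrite /line mmapX mmap1U. Qed.
Lemma lineD p q : line z d (p + q) = line z d p + line z d q.
Proof. exact: rmorphD. Qed.
Lemma lineM p q : line z d (p * q) = line z d p * line z d q.
Proof. exact: rmorphM. Qed.

Lemma horner_line p t : (line z d p).[t] = p.@[fun k => z k + d k * t].
Proof.
elim/mpoly_alg_ind: p => [c|i|p q Hp Hq|p q Hp Hq].
- by rewrite lineC mevalC hornerC.
- by rewrite lineX mevalXU !hornerE.
- by rewrite lineD mevalD hornerD Hp Hq.
- by rewrite lineM mevalM hornerM Hp Hq.
Qed.

Lemma deriv_line p : (line z d p)^`() = \sum_k d k *: line z d (mderiv k p).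
Proof.
elim/mpoly_alg_ind: p => [c|i|p q Hp Hq|p q Hp Hq].
- rewrite lineC derivC big1 // => k _.
  by rewrite mderivC -mpolyC0 lineC scaler0.
- rewrite lineX derivD derivC derivZ derivX add0r (bigD1 i) //= big1 => [|k ki].
    rewrite mderivX mnm1E eqxx scale1r.
    have -> : (U_(i) - U_(i))%MM = 0%MM :> 'X_{1..n}.
      by apply/mnmP => k; rewrite mnmBE subnn mnm0E.
    by rewrite mpolyX0 -mpolyC1 lineC addr0 alg_polyC.
  by rewrite mderivX mnm1E eq_sym (negPf ki) scale0r -mpolyC0 lineC scaler0.
- rewrite lineD derivD Hp Hq -big_split; apply: eq_bigr => k _ /=.
  by rewrite mderivD lineD scalerDr.
- rewrite lineM derivM Hp Hq mulr_suml mulr_sumr -big_split.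
  apply: eq_bigr => k _ /=.
  by rewrite mderivM lineD !lineM scalerDr scalerAl scalerAr.
Qed.

Lemma horner0_line p : (line z d p).[0] = p.@[z].
Proof. by rewrite horner_line; apply: meval_eq => k; rewrite mulr0 addr0. Qed.
End Line.

Definition unit_dir n (R : comNzRingType) (i : 'I_n) (k : 'I_n) : R := (k == i)%:R.

Lemma deriv_line_unit_dir n (R : comNzRingType) (z : 'I_n -> R) i (p : {mpoly R[n]}) :
  (line z (unit_dir R i) p)^`() = line z (unit_dir R i) (mderiv i p).
Proof.
rewrite deriv_line (bigD1 i) //= big1 => [|k ki].
  by rewrite /unit_dir eqxx scale1r addr0.
by rewrite /unit_dir (negPf ki) scale0r.
Qed.

(** Exact second-order Taylor formula: a vanishing third derivative bounds the degree of the
    restriction by 2 in characteristic 0. *)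
Lemma mevalD_unit_dir n (R : numFieldType) (z : 'I_n -> R) i t (p : {mpoly R[n]}) :
  mderiv i (mderiv i (mderiv i p)) = 0 ->
  p.@[fun k => z k + unit_dir R i k * t] =
  p.@[z] + (mderiv i p).@[z] * t + 2%:R^-1 * (mderiv i (mderiv i p)).@[z] * t ^+ 2.
Proof.
move=> D3; rewrite -horner_line; set q := line _ _ p.
have q1 : q^`() = line z (unit_dir R i) (mderiv i p) by exact: deriv_line_unit_dir.
have q2 : q^`(2) = line z (unit_dir R i) (mderiv i (mderiv i p)).
  by rewrite derivnS derivn1 q1 deriv_line_unit_dir.
have q3 : q^`(3) = 0.
  by rewrite derivnS q2 deriv_line_unit_dir D3 -mpolyC0 lineC.
have sq : (size q <= 3)%N.
  apply/leq_sizeP => j /subnKC <-.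
  have := coef_derivn 3 q (j - 3); rewrite q3 coef0 => /esym/eqP.
  by rewrite mulrn_eq0 eqn0Ngt ffact_gt0 leq_addr => /eqP.
rewrite (horner_coef_wide _ sq) 2!big_ord_recr big_ord1 /= expr0 mulr1 expr1.
have c0 : q`_0 = p.@[z] by rewrite -horner_coef0 horner0_line.
have c1 : q`_1 = (mderiv i p).@[z].
  by have := congr1 (fun r => r.[0]) q1; rewrite /= horner0_line => <-;
    rewrite horner_coef0 coef_deriv.
have c2 : q`_2 *+ 2 = (mderiv i (mderiv i p)).@[z].
  have := congr1 (fun r => r.[0]) q2; rewrite /= horner0_line => <-.
  by rewrite horner_coef0 !coef_deriv -mulrnA.
by rewrite c0 c1 -c2 -[q`_2 *+ 2]mulr_natl mulKf ?pnatr_eq0.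
Qed.

(** * Stable polynomials *)

Section Stable.
Context (C : numClosedFieldType) (n : nat).
Implicit Types (p : {mpoly C[n]}) (w z : 'I_n -> C) (a : C).

Definition stable p := forall w, (forall k, 0 < 'Im (w k)) -> p.@[w] != 0.

(** The logarithmic derivative at 0 is the sum of the [- 1 / r], each with negative imaginary part;
    multiplying by [|q(0)|^2] avoids the division. Equality leaves no roots, hence a constant
    [q]. *)
Lemma im_deriv_lower_roots (c : C) (rs : seq C) :
  c != 0 -> all (fun r => 'Im r < 0) rs ->
  let q := c *: \prod_(r <- rs) ('X - r%:P) in
  [/\ q.[0] != 0, 'Im (q^`().[0] * q.[0]^*) <= 0 &
      'Im (q^`().[0] * q.[0]^*) = 0 -> q^`().[0] = 0].
Proof.
move=> c0; elim: rs => [_|r rs IH /andP[r0 /IH]] /=.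
  rewrite big_nil derivZ derivC scaler0 horner0 mul0r raddf0.
  by split=> //; rewrite hornerZ hornerC mulr1.
set q := c *: _ => -[q0 qle _]; rewrite big_cons scalerAr -/q.
set A := q.[0] in q0 qle *; set B := q^`().[0] in qle *.
have E1 : (('X - r%:P) * q).[0] = - r * A by rewrite hornerM hornerXsubC sub0r.
have E2 : (('X - r%:P) * q)^`().[0] = A - r * B.
  by rewrite derivM derivXsubC mul1r hornerD hornerM hornerXsubC sub0r mulNr.
have rn0 : r != 0 by apply: contraTneq r0 => ->; rewrite raddf0 ltxx.
have neg : 'Im ((A - r * B) * (- r * A)^*) < 0.
  have -> : (A - r * B) * (- r * A)^* =
            `|A| ^+ 2 * (- r^*) + `|r| ^+ 2 * (B * A^*).
    by rewrite rmorphM rmorphN !normCK; ring.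
  have nR (x : C) : `|x| ^+ 2 \is Num.real by rewrite rpredX ?normr_real.
  rewrite raddfD /= (ImMl (nR A)) (ImMl (nR r)).
  have -> : 'Im (- r^*) = 'Im r by rewrite raddfN /= Im_conj opprK.
  apply: ltr_nwDl; last by rewrite mulr_ge0_le0 ?exprn_ge0.
  by rewrite pmulr_rlt0 // exprn_gt0 // normr_gt0.
rewrite E1 E2; split; first by rewrite mulf_neq0 // oppr_eq0.
  exact: ltW.
by move=> E; rewrite E ltxx in neg.
Qed.

(** On the line through [w] in direction [i], a root with nonnegative imaginary part would be a zero
    of [p] with all coordinates in the upper half-plane. *)
Lemma stable_deriv p i w : stable p -> (forall k, 0 < 'Im (w k)) ->
  'Im ((mderiv i p).@[w] * (p.@[w])^*) <= 0 /\
  ('Im ((mderiv i p).@[w] * (p.@[w])^*) = 0 -> (mderiv i p).@[w] = 0).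
Proof.
move=> sp Hw; pose q := line w (unit_dir C i) p.
have q0 : q.[0] != 0 by rewrite horner0_line sp.
have [rs Eq] := closed_field_poly_normal q.
have lc0 : lead_coef q != 0.
  by rewrite lead_coef_eq0; apply: contraNneq q0 => ->; rewrite horner0.
have lower : all (fun r => 'Im r < 0) rs.
  apply/allP => r rin; have : root q r.
    by rewrite Eq rootZ // root_prod_XsubC.
  apply: contraTT => r0; rewrite rootE horner_line sp // => k.
  have r1 : 0 <= 'Im r by rewrite real_leNgt ?real0 ?Creal_Im.
  rewrite raddfD /= ImMl ?realn // ltr_pwDl // mulr_ge0 //.
have [_] := im_deriv_lower_roots lc0 lower; rewrite -Eq horner0_line.
by rewrite deriv_line_unit_dir horner0_line.
Qed.

(** At a zero, [p = a d_i p] makes [d_i p * conj p] real, so [stable_deriv] forces [d_i p = 0] and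
    then [p = 0]. *)
Lemma stable_sub_deriv p i a : a \is Num.real -> stable p ->
  stable (p - a%:MP * mderiv i p).
Proof.
move=> ar sp w Hw; have [_ H] := stable_deriv i sp Hw.
rewrite mevalB mevalM mevalC subr_eq0; apply/eqP => E.
have D0 : (mderiv i p).@[w] = 0.
  apply: H; rewrite E rmorphM /= (conj_Creal ar) mulrCA -normCK.
  by rewrite ImMl // (Creal_ImP _ _) ?mulr0 // rpredX // normr_real.
by have := sp w Hw; rewrite E D0 mulr0 eqxx.
Qed.

(* [1 - d^2 / 2 = (1 - a d) (1 + a d)] with [a = 1 / sqrt 2]. *)
Lemma stable_op p i : stable p ->
  stable (p - (2%:R^-1 : C)%:MP * mderiv i (mderiv i p)).
Proof.
move=> sp; pose a : C := (sqrtC 2)^-1.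
have ar : a \is Num.real by rewrite ger0_real // invr_ge0 sqrtC_ge0 ler0n.
have -> : p - (2%:R^-1 : C)%:MP * mderiv i (mderiv i p) =
  (p - a%:MP * mderiv i p) - (- a)%:MP * mderiv i (p - a%:MP * mderiv i p).
  have -> : 2%:R^-1 = a * a by rewrite /a -invfM -expr2 sqrtCK.
  rewrite mderivB mderiv_mulC mpolyCN mpolyCM; ring.
by apply: stable_sub_deriv; rewrite ?rpredN //; apply: stable_sub_deriv.
Qed.
End Stable.

Lemma le0_of_le_small_real (C : numClosedFieldType) (K M : C) :
  K \is Num.real -> 0 <= M ->
  (forall s, 0 < s -> s <= 1 -> K <= s * M) -> K <= 0.
Proof.
move=> /realpartP[k ->] M0; have /realpartP[m Em] := ger0_real M0; subst M.
by move=> H; apply: (@le0_of_le_small (realpart C) k m M0) => s; apply: (H (rval s)).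
Qed.

Lemma poly_bounded (C : numClosedFieldType) (q : {poly C}) :
  exists2 M : C, 0 <= M & forall t, `|t| <= 1 -> `|q.[t]| <= M.
Proof.
elim/poly_ind: q => [|q c [M M0 IH]].
  by exists 0 => // t _; rewrite horner0 normr0.
exists (M + `|c|) => [|t t1]; first by rewrite addr_ge0.
rewrite !hornerE (le_trans (ler_normD _ _)) // lerD2r normrM.
by rewrite -[leRHS]mulr1 ler_pM // IH.
Qed.

Lemma poly_expand2 (R : comNzRingType) (q : {poly R}) :
  exists r : {poly R}, q = (q.[0])%:P + q^`().[0] *: 'X + r * 'X ^+ 2.
Proof.
elim/poly_ind: q => [|q c _]; first by 
  by exists 0; rewrite deriv0 horner0 scale0r mul0r polyC0 !addr0.
elim/poly_ind: q => [|q b _].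
  by exists 0; rewrite !mul0r !add0r addr0 hornerC derivC horner0 scale0r addr0.
exists q.
have -> : ((q * 'X + b%:P) * 'X + c%:P).[0] = c.
  by rewrite hornerMXaddC mulr0 add0r.
have -> : ((q * 'X + b%:P) * 'X + c%:P)^`().[0] = b.
  by rewrite derivMXaddC hornerD hornerMX mulr0 addr0 hornerMXaddC mulr0 add0r.
by rewrite -mul_polyC; ring.
Qed.

(** * Rayleigh inequalities for real stable polynomials *)

Section Rayleigh.
Context (C : numClosedFieldType) (n : nat).
Implicit Types (p : {mpoly C[n]}) (w z : 'I_n -> C).

Definition conj_real p := map_mpoly (@Num.conj C) p = p.

Lemma conj_meval p w : conj_real p -> (p.@[w])^* = p.@[fun k => (w k)^*].
Proof. by move=> pr; rewrite -{2}pr meval_map. Qed.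

Lemma meval_real p z : conj_real p -> (forall k, z k \is Num.real) ->
  p.@[z] \is Num.real.
Proof.
move=> pr zr; apply/CrealP; rewrite conj_meval //.
by apply: meval_eq => k; rewrite conj_Creal.
Qed.

Lemma conj_real_deriv p i : conj_real p -> conj_real (mderiv i p).
Proof. by move=> pr; rewrite /conj_real map_mderiv pr. Qed.

(* First order expansion at [s = 0] of [Im (d_i p * conj p) <= 0] at [z + i s d];
   since [p] is real, its conjugate there is its value at [z - i s d]. *)
Lemma rayleigh_dir p i z d : stable p -> conj_real p ->
  (forall k, z k \is Num.real) -> (forall k, 0 < d k) ->
  p.@[z] * (\sum_k d k * (mderiv k (mderiv i p)).@[z]) <=
  (mderiv i p).@[z] * (\sum_k d k * (mderiv k p).@[z]).
Proof.
move=> sp pr zr d0; rewrite -subr_le0.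
pose F := line z d p; pose G := line z d (mderiv i p).
(* A polynomial in [s], free of conjugation, whose value at ['i * s] is [d_i p * conj p] at
   [z + i s d]. *)
pose K := G * (F \Po (- 'X)).
have dr k : d k \is Num.real by rewrite gtr0_real.
have pir := conj_real_deriv i pr.
have dF q : (line z d q)^`().[0] = \sum_k d k * (mderiv k q).@[z].
  rewrite deriv_line horner_sum; apply: eq_bigr => k _.
  by rewrite hornerZ horner0_line.
have K0 : K.[0] = (mderiv i p).@[z] * p.@[z].
  by rewrite hornerM horner_comp hornerN hornerX oppr0 !horner0_line.
have K1 : K^`().[0] = p.@[z] * (\sum_k d k * (mderiv k (mderiv i p)).@[z]) -
   (mderiv i p).@[z] * (\sum_k d k * (mderiv k p).@[z]).
  rewrite derivM deriv_comp derivN derivX hornerD !hornerM !horner_comp.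
  rewrite !hornerN hornerX oppr0 !dF !horner0_line hornerC; ring.
have rsum q : conj_real q -> \sum_k d k * (mderiv k q).@[z] \is Num.real.
  by move=> qr; apply: rpred_sum => k _; rewrite rpredM // meval_real //;
    apply: conj_real_deriv.
rewrite -K1; have [r EK] := poly_expand2 K; have [M M0 HM] := poly_bounded r.
have K0r : K.[0] \is Num.real by rewrite K0 rpredM // meval_real.
have K1r : K^`().[0] \is Num.real.
  by rewrite K1 rpredB ?rpredM ?meval_real // rsum.
apply: (@le0_of_le_small_real C _ M) => // s s0 s1.
have sr : s \is Num.real by rewrite gtr0_real.
pose w k := z k + d k * ('i * s).
have Hw k : 0 < 'Im (w k).
  rewrite /w mulrCA raddfD /= (Creal_ImP _ (zr k)) add0r ImMil.
  by rewrite (Creal_ReP _ _) ?rpredM // mulr_gt0.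
have [H _] := stable_deriv i sp Hw.
have EKs : K.['i * s] = (mderiv i p).@[w] * (p.@[w])^*.
  rewrite hornerM horner_comp hornerN hornerX !horner_line conj_meval //.
  congr (_ * _); apply: meval_eq => k.
  by rewrite /w rmorphD !rmorphM /= conjCi !conj_Creal // mulNr.
rewrite -EKs EK !hornerD hornerC hornerZ hornerX (hornerM r) hornerXn in H.
(* Imaginary part of the expansion at ['i * s]: the real [K.[0]] drops out and the remainder picks
   up [i^2 = -1]. *)
have : s * K^`().[0] - s ^+ 2 * 'Im r.['i * s] <= 0.
  apply: le_trans H; rewrite le_eqVlt; apply/orP; left; apply/eqP.
  rewrite exprMn sqrCi !raddfD /= (Creal_ImP _ K0r) add0r.
  have -> : K^`().[0] * ('i * s) = 'i * (K^`().[0] * s) by ring.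
  rewrite ImMil (Creal_ReP _ _) ?rpredM //.
  have -> : r.['i * s] * (-1 * s ^+ 2) = (- s ^+ 2) * r.['i * s] by ring.
  by rewrite ImMl ?rpredN ?rpredX // mulNr mulrC.
rewrite subr_le0 expr2 -mulrA ler_pM2l // => h. apply: le_trans h _.
rewrite ler_pM2l //; apply: le_trans (HM ('i * s) _).
  set y := r.[_]; have -> : 'Im y = 'Re ('i * - y) by rewrite ReMil raddfN /= opprK.
  by rewrite (le_trans (leif_Re_Creal _)) // normrM normCi mul1r normrN.
by rewrite normrM normCi mul1r ger0_norm // ltW.
Qed.

(* Let the direction in [rayleigh_dir] tend to the [j]-th basis vector. *)
Lemma rayleigh p i j z : stable p -> conj_real p ->
  (forall k, z k \is Num.real) ->
  p.@[z] * (mderiv j (mderiv i p)).@[z] <= (mderiv i p).@[z] * (mderiv j p).@[z].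
Proof.
move=> sp pr zr; have pir := conj_real_deriv i pr.
rewrite -subr_le0.
pose L q := \sum_k (mderiv k q).@[z].
pose M := (mderiv i p).@[z] * L p - p.@[z] * L (mderiv i p).
have Lr q : conj_real q -> L q \is Num.real.
  by move=> qr; apply: rpred_sum => k _; rewrite meval_real //; apply: conj_real_deriv.
have Mr : M \is Num.real.
  by rewrite rpredB // rpredM ?Lr // meval_real.
apply: (@le0_of_le_small_real C _ `|M|) => // [|s s0 _].
  by rewrite rpredB ?rpredM ?meval_real //; do ?apply: conj_real_deriv.
(* Adding [s] to every coordinate keeps the direction strictly positive; its contribution is [s]
   times the sum [L] of all partial derivatives. *)
have := @rayleigh_dir p i z (fun k => (k == j)%:R + s) sp pr zr.
have E q : \sum_k ((k == j)%:R + s) * (mderiv k q).@[z] = (mderiv j q).@[z] + s * L q.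
  under eq_bigr do rewrite mulrDl.
  rewrite big_split /= -mulr_sumr (bigD1 j) //= eqxx mul1r.
  rewrite big1 ?addr0 // => k /negPf ->; by rewrite mul0r.
rewrite !E => H; have {}H := H (fun k => ltr_wpDl (ler0n _ _) s0).
have : p.@[z] * (mderiv j (mderiv i p)).@[z] -
    (mderiv i p).@[z] * (mderiv j p).@[z] <= s * M.
  rewrite -subr_ge0 in H; rewrite -subr_ge0.
  apply: le_trans H _; rewrite le_eqVlt; apply/orP; left; apply/eqP.
  by rewrite /M; ring.
move=> h; apply: le_trans h _; rewrite ler_pM2l //; exact: real_ler_norm.
Qed.
End Rayleigh.

(** * The barrier argument *)

Section RealTransfer.
Context (C : numClosedFieldType).
Implicit Types a b c k s m : C.

Lemma quad_coef_ge0_real a b c :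
  a \is Num.real -> b \is Num.real -> c \is Num.real ->
  (forall t, t \is Num.real ->
     (a + b * t + c * t ^+ 2) * (2 * c) <= (b + 2 * c * t) ^+ 2) ->
  (forall t, 0 <= t -> 0 < a + b * t + c * t ^+ 2) ->
  0 <= b /\ 0 <= c.
Proof.
move=> /realpartP[a' ->] /realpartP[b' ->] /realpartP[c' ->] H1 H2.
apply: (@quad_coef_ge0 (realpart C) a' b' c').
  by move=> t; apply: (H1 (rval t) (rvalP t)).
by move=> t; apply: (H2 (rval t)).
Qed.

Lemma barrier_step_real a b c a' b' c' k s m :
  a \is Num.real -> b \is Num.real -> c \is Num.real ->
  a' \is Num.real -> b' \is Num.real -> c' \is Num.real -> m \is Num.real ->
  2 < s -> 0 <= k -> 0 < a -> 0 <= b -> 0 <= c ->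
  a * (2 * c) <= b ^+ 2 -> s * b <= 2 * k * a ->
  (forall t, t \is Num.real ->
     (a + b * t + c * t ^+ 2) * (b' + 2 * c' * t) <=
     (b + 2 * c * t) * (a' + b' * t + c' * t ^+ 2)) ->
  s * a' <= m * a ->
  0 < a + b * k + c * (k ^+ 2 - 1) /\
  s * (a' + b' * k + c' * (k ^+ 2 - 1)) <= m * (a + b * k + c * (k ^+ 2 - 1)).
Proof.
move=> /realpartP[A ->] /realpartP[B ->] /realpartP[c0 ->].
move=> /realpartP[A' ->] /realpartP[B' ->] /realpartP[c0' ->] /realpartP[M ->].
move=> s2 k0.
have /realpartP[K EK] := ger0_real k0; subst k.
have /realpartP[S ES] : s \is Num.real by rewrite -(ler_real (ltW s2)) realn.
subst s => a0 b0 c00 h1 h2 h3.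
apply: (@barrier_step (realpart C) A B c0 A' B' c0' K S M) => // t.
exact: (h3 (rval t) (rvalP t)).
Qed.
End RealTransfer.

Section Barrier.
Context (C : numClosedFieldType) (n : nat) (s : C) (kappa : 'I_n -> C).
Hypotheses (s2 : 2 < s) (kappa_ge0 : forall i, 0 <= kappa i).
Implicit Types (p : {mpoly C[n]}) (S : seq 'I_n) (w : 'I_n -> C).

Definition half_op i p := p - (2%:R^-1 : C)%:MP * mderiv i (mderiv i p).

(** [S] lists the processed variables; processing one raises its lower bound from [- kappa] to 0. *)
Definition above S w := forall k, (if k \in S then 0 else - kappa k) <= w k.

Record barrier S p : Prop := Barrier {
  barrier_stable : stable p;
  barrier_conj : conj_real p;
  barrier_deg : forall i, mderiv i (mderiv i (mderiv i p)) = 0;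
  barrier_gt0 : forall w, above S w -> 0 < p.@[w];
  barrier_deriv : forall w j, above S w -> j \notin S ->
    s * (mderiv j p).@[w] <= 2 * kappa j * p.@[w] }.

Lemma above_real S w : above S w -> forall k, w k \is Num.real.
Proof.
move=> H k; rewrite -(ler_real (H k)); case: ifP => // _.
by rewrite rpredN ger0_real.
Qed.

Lemma mderiv_half_op i j p : mderiv j (half_op i p) = half_op i (mderiv j p).
Proof.
by rewrite /half_op mderivB mderiv_mulC !(mderiv_comm i j).
Qed.

Lemma barrier_half_op S p i : i \notin S -> barrier S p ->
  barrier (i :: S) (half_op i p).
Proof.
move=> iS [sp pr p3 p0 pd].
have main w : above (i :: S) w -> 0 < (half_op i p).@[w] /\
   forall j, j \notin i :: S ->
     s * (mderiv j (half_op i p)).@[w] <= 2 * kappa j * (half_op i p).@[w].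
  move=> Hw; pose k := kappa i.
  have k0 : 0 <= k by exact: kappa_ge0.
  (* Stepping back by [kappa i] lands in the old orthant, and [w] is the point [t = k] of the line
     from [w']. *)
  pose w' l := w l + unit_dir C i l * (- k).
  have Hw' t : 0 <= t -> above S (fun l => w' l + unit_dir C i l * t).
    move=> t0 l; have := Hw l; rewrite /w' /unit_dir inE.
    have [->|li] /= := eqVneq l i.
      by rewrite (negPf iS) !mul1r => h; rewrite addrAC lerDr addr_ge0.
    by rewrite !mul0r !addr0.
  have w'r l : w' l \is Num.real.
    by have := above_real (Hw' 0 (lexx _)) l; rewrite mulr0 addr0.
  have Aw' : above S w'.
    by move=> l; have := Hw' 0 (lexx _) l; rewrite mulr0 addr0.
  have w'tr t : t \is Num.real -> forall l, w' l + unit_dir C i l * t \is Num.real.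
    by move=> tr l; rewrite rpredD // rpredM // realn.
  have Ew q : q.@[w] = q.@[fun l => w' l + unit_dir C i l * k].
    by apply: meval_eq => l; rewrite /w' mulrN subrK.
  have two0 : (2 : C) != 0 by rewrite pnatr_eq0.
  have ex1 q t : mderiv i (mderiv i (mderiv i q)) = 0 ->
    (mderiv i q).@[fun l => w' l + unit_dir C i l * t] =
    (mderiv i q).@[w'] + 2 * (2%:R^-1 * (mderiv i (mderiv i q)).@[w']) * t.
    move=> q3; rewrite mevalD_unit_dir ?q3 ?mderiv0 //.
    by rewrite meval0 mulr0 mul0r addr0 mulrA divff // mul1r.
  have ex2 q t : mderiv i (mderiv i (mderiv i q)) = 0 ->
    (mderiv i (mderiv i q)).@[fun l => w' l + unit_dir C i l * t] =
    (mderiv i (mderiv i q)).@[w'].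
    move=> q3; rewrite mevalD_unit_dir ?q3 ?mderiv0 //.
    by rewrite !meval0 mulr0 !mul0r !addr0.
  have exop q : mderiv i (mderiv i (mderiv i q)) = 0 ->
    (half_op i q).@[w] = q.@[w'] + (mderiv i q).@[w'] * k +
      (2%:R^-1 * (mderiv i (mderiv i q)).@[w']) * (k ^+ 2 - 1).
    move=> q3; rewrite /half_op mevalB mevalM mevalC !Ew ex2 // mevalD_unit_dir //.
    by ring.
  have ray j t : t \is Num.real -> _ := fun tr => rayleigh i j sp pr (w'tr t tr).
  have conj_d q j := @conj_real_deriv C n q j.
  have half_real : (2%:R^-1 : C) \is Num.real by rewrite rpredV realn.
  set A := p.@[w']; set B := (mderiv i p).@[w'].
  set c := 2%:R^-1 * (mderiv i (mderiv i p)).@[w'].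
  have Ar : A \is Num.real by exact: meval_real.
  have Br : B \is Num.real by apply: meval_real => //; apply: (conj_d).
  have cr : c \is Num.real.
    by rewrite rpredM //; apply: meval_real => //; do 2 apply: (conj_d).
  have A0 : 0 < A by exact: p0.
  have exp_ t := mevalD_unit_dir w' t (p3 i).
  have [B0 c0] : 0 <= B /\ 0 <= c.
    apply: (quad_coef_ge0_real Ar Br cr) => t tr; last first.
      by have := p0 _ (Hw' t tr); rewrite exp_.
    have := ray i t tr; rewrite exp_ ex2 // ex1 // expr2.
    by rewrite /c (mulrA 2) divff // mul1r.
  have h1 : A * (2 * c) <= B ^+ 2.
    have := ray i 0 (rpred0 _); rewrite exp_ ex2 // ex1 // !mulr0 expr0n /= mulr0.
    rewrite !addr0.
    by rewrite /c (mulrA 2) divff // mul1r expr2.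
  have h2 : s * B <= 2 * k * A by exact: pd.
  have step j m : m \is Num.real -> s * (mderiv j p).@[w'] <= m * A ->
      i != j ->
      s * (mderiv j (half_op i p)).@[w] <= m * (half_op i p).@[w].
    move=> mr hm ij.
    have q3 : mderiv i (mderiv i (mderiv i (mderiv j p))) = 0.
      by rewrite !(mderiv_comm j i) p3 mderiv0.
    have cj := conj_d _ j pr.
    rewrite mderiv_half_op !exop //.
    apply: (proj2 (barrier_step_real Ar Br cr _ _ _ mr s2 _ A0 B0 c0 h1 h2 _ hm)) => //.
    - exact: meval_real.
    - by apply: meval_real => //; apply: (conj_d).
    - by rewrite rpredM //; apply: meval_real => //; do 2 apply: (conj_d).
    move=> t tr; have := ray j t tr.
    rewrite exp_ (ex1 p t (p3 i)) (mderiv_comm i j) (ex1 _ t q3).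
    by rewrite (mevalD_unit_dir _ _ q3).
  split.
    (* Only positivity is wanted here, so the data of the second polynomial are set to 0. *)
    rewrite exop //; apply: (proj1 (barrier_step_real (m := 0) (a' := 0) (b' := 0)
      (c' := 0) Ar Br cr _ _ _ _ s2 _ A0 B0 c0 h1 h2 _ _)) => // [t _|].
      by rewrite !(mulr0, mul0r, addr0).
    by rewrite mulr0 mul0r.
  move=> j; rewrite inE negb_or eq_sym => /andP[ij jS].
  apply: step => //; last exact: pd.
  by rewrite rpredM ?realn // ger0_real.
split.
- exact: stable_op.
- rewrite /conj_real rmorphB rmorphM /= map_mpolyC /= !map_mderiv pr.
  by rewrite fmorphV rmorph_nat.
- by move=> j; rewrite !mderiv_half_op p3 /half_op !mderiv0 mulr0 subr0.
- by move=> w /main[].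
- by move=> w j /main[_ H]; apply: H.
Qed.
End Barrier.

(** * The determinantal polynomial *)

Section RankOne.
Context (R : comPzRingType) (d : nat).
Implicit Types (M : 'M[R]_d) (u : 'cV[R]_d) (v : 'rV[R]_d).

(** Exhibits the determinant as affine in [t], without inverting [M]: block elimination turns it
    into a bordered determinant with last row [(t v, 1)], which splits as [t (v, 0) + (0, 1)]. *)
Lemma det_rank_one M u v (t : R) :
  \det (M + t *: (u *m v)) = \det M + t * \det (block_mx M (- u) v 0).
Proof.
pose A := block_mx M (- u) (t *: v) (1%:M : 'M_1).
have -> : \det (M + t *: (u *m v)) = \det A.
  have E : block_mx 1%:M u 0 1%:M *m A = block_mx (M + t *: (u *m v)) 0 (t *: v) 1%:M.
    rewrite mulmx_block !mul1mx !mul0mx !add0r mulmx1 addNr.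
    by rewrite -scalemxAr.
  have := congr1 determinant E; rewrite det_mulmx det_ublock det_lblock !det1 !mul1r.
  by rewrite mulr1.
rewrite (@determinant_multilinear _ _ A (block_mx M (- u) v 0)
  (block_mx M (- u) 0 1%:M) (rshift d 0) t 1).
- by rewrite det_ublock det1 mulr1 mul1r addrC.
- apply/rowP => j; rewrite !mxE; case: splitP => // k' Ek.
    by have := ltn_ord k'; rewrite -Ek /= addn0 ltnn.
  by rewrite !mxE; case: splitP => k _; rewrite !mxE ?mulr0 ?addr0 ?mul1r ?add0r.
- apply/matrixP => i j; rewrite !mxE; case: splitP => // k Ek.
  by case/eqP: (neq_lift (rshift d 0) i); apply/val_inj; rewrite [RHS]Ek (ord1 k).
- apply/matrixP => i j; rewrite !mxE; case: splitP => // k Ek.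
  by case/eqP: (neq_lift (rshift d 0) i); apply/val_inj; rewrite [RHS]Ek (ord1 k).
Qed.
End RankOne.

Lemma mderiv_det0 n (R : comNzRingType) d (A : 'M[{mpoly R[n]}]_d) i :
  (forall a b, mderiv i (A a b) = 0) -> mderiv i (\det A) = 0.
Proof.
move=> A0; rewrite raddf_sum big1 //= => s _.
have sgn0 (b : bool) q : mderiv i q = 0 -> mderiv i ((-1) ^+ b * q) = 0.
  by move=> q0; rewrite mulr_sign; case: b; rewrite ?mderivN q0 ?oppr0.
apply: sgn0; apply: (big_ind (fun q => mderiv i q = 0)) => //.
  by rewrite -mpolyC1 mderivC.
by move=> q r q0 r0; rewrite mderivM q0 r0 mul0r mulr0 addr0.
Qed.

(** * Hermitian forms and Cauchy-Schwarz *)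

Section Form.
Context (C : numClosedFieldType) (d : nat).
Implicit Types (y : 'rV[C]_d) (v : 'cV[C]_d).

Lemma adjmxM m k l (A : 'M[C]_(m, k)) (B : 'M[C]_(k, l)) :
  adjmx (A *m B) = adjmx B *m adjmx A.
Proof. by rewrite /adjmx map_mxM trmx_mul. Qed.

Lemma adjmxK m k (A : 'M[C]_(m, k)) : adjmx (adjmx A) = A.
Proof. by apply/matrixP => a b; rewrite !mxE conjCK. Qed.

(** Forms are taken on row vectors because [det0P] supplies a left null vector. *)
Definition sqnorm y : C := (y *m adjmx y) 0 0.
Definition pairing y v : C := (y *m v) 0 0.

Lemma sqnormE y : sqnorm y = \sum_k `|y 0 k| ^+ 2.
Proof. by rewrite /sqnorm mxE; apply: eq_bigr => k _; rewrite !mxE normCK. Qed.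

Lemma sqnorm_ge0 y : 0 <= sqnorm y.
Proof. by rewrite sqnormE sumr_ge0 // => k _; rewrite exprn_ge0. Qed.

Lemma sqnorm_gt0 y : y != 0 -> 0 < sqnorm y.
Proof.
move=> y0; rewrite lt_def sqnorm_ge0 andbT; apply: contra_neq y0.
rewrite sqnormE => /psumr_eq0P H; apply/rowP => k; rewrite mxE.
by apply/eqP; rewrite -normr_eq0 -sqrf_eq0 H // => j _; rewrite exprn_ge0.
Qed.

Lemma outer_form y v : (y *m outer v *m adjmx y) 0 0 = `|pairing y v| ^+ 2.
Proof.
rewrite /outer mulmxA -mulmxA -adjmxM mxE big_ord1 normCK /pairing.
by congr (_ * _); rewrite /adjmx !mxE.
Qed.

Lemma outer_sq v : outer v *m outer v = sqnorm (adjmx v) *: outer v.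
Proof.
rewrite /outer mulmxA -(mulmxA v) [adjmx v *m v]mx11_scalar.
by rewrite /sqnorm adjmxK mul_mx_scalar scalemxAl.
Qed.

(** Cauchy-Schwarz, from the nonnegative square norm of [N y - (y v) v^*], which equals
    [N (N |y|^2 - |y v|^2)]. *)
Lemma coef_le y v : `|pairing y v| ^+ 2 <= sqnorm (adjmx v) * sqnorm y.
Proof.
set N := sqnorm (adjmx v); have N0 : 0 <= N by exact: sqnorm_ge0.
have [Nz|Nz] := eqVneq N 0.
  have v0 : adjmx v = 0.
    by apply/eqP; apply: contraT => /sqnorm_gt0; rewrite -/N Nz ltxx.
  rewrite Nz mul0r /pairing -[v]adjmxK v0.
  have -> : adjmx (0 : 'rV[C]_d) = 0 by rewrite /adjmx map_mx0 trmx0.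
  by rewrite mulmx0 mxE normr0 expr0n.
have Np : 0 < N by rewrite lt_def Nz.
have := sqnorm_ge0 (N *: y - pairing y v *: adjmx v).
have -> : sqnorm (N *: y - pairing y v *: adjmx v) =
          N * (N * sqnorm y - `|pairing y v| ^+ 2).
  have adjZ a (z : 'rV[C]_d) : adjmx (a *: z) = a^* *: adjmx z.
    by apply/matrixP => i j; rewrite !mxE rmorphM.
  have adjB (z z' : 'rV[C]_d) : adjmx (z - z') = adjmx z - adjmx z'.
    by apply/matrixP => i j; rewrite !mxE rmorphB.
  have e1 : adjmx v *m adjmx y = (pairing y v)^*%:M.
    rewrite -adjmxM [y *m v]mx11_scalar -/(pairing y v).
    by apply/matrixP => i j; rewrite !ord1 !mxE !mulr1n.
  have e2 : y *m v = (pairing y v)%:M by exact: mx11_scalar.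
  have e3 : y *m adjmx y = (sqnorm y)%:M by exact: mx11_scalar.
  have e4 : adjmx v *m v = N%:M by rewrite /N /sqnorm adjmxK; exact: mx11_scalar.
  rewrite {1}/sqnorm adjB !adjZ adjmxK mulmxBl !mulmxBr -!scalemxAl -!scalemxAr.
  rewrite e1 e2 e3 e4 !mxE /= !mulr1n (conj_Creal (ger0_real N0)) normCK; ring.
by rewrite pmulr_rge0 // subr_ge0.
Qed.
End Form.

(** * The pencil at a fixed real [x > 3] and its barrier *)

Section Determinant.
Context (C : numClosedFieldType) (d n : nat) (v : 'I_n -> 'cV[C]_d) (tau : 'I_n -> C).
Context (x : C).
Hypotheses (htau : forall i, 0 < tau i) (xreal : x \is Num.real) (x3 : 3 < x).
Implicit Types (w : 'I_n -> C) (y : 'rV[C]_d).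

Definition pencil w : 'M[C]_d := x%:M + \sum_i (w i * tau i) *: outer (v i).

Definition pencil_poly : 'M[{mpoly C[n]}]_d :=
  \matrix_(a, b) ((x * (a == b)%:R)%:MP +
                  \sum_(i < n) 'X_i * (tau i * outer (v i) a b)%:MP).

(** The trace of [A_i = tau_i v_i v_i^*], so that [A_i^2 = weight i * A_i]. *)
Definition weight i := tau i * sqnorm (adjmx (v i)).

Lemma map_detsq : map_mpoly (horner_eval x) (detsq tau v) = (\det pencil_poly) ^+ 2.
Proof.
rewrite rmorphXn /= -det_map_mx; congr (\det _ ^+ 2).
apply/matrixP => a b; rewrite !mxE rmorphD rmorph_sum /= map_mpolyC; congr (_%:MP + _).
  by rewrite /= /horner_eval hornerM hornerX; case: (a == b); rewrite hornerC.
apply: eq_bigr => i _.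
by rewrite rmorphM /= map_mpolyX map_mpolyC /= /horner_eval hornerC.
Qed.

Lemma map_op_i i (q : {mpoly {poly C}[n]}) :
  map_mpoly (horner_eval x) (op_i i q) = half_op i (map_mpoly (horner_eval x) q).
Proof.
rewrite /op_i /half_op rmorphB rmorphM /= map_mpolyC /= !map_mderiv.
by rewrite /horner_eval hornerC.
Qed.

(** The operators act on the [z_i] alone, so [x] may be specialised before they are applied. *)
Lemma horner_p_empty : (p_empty tau v).[x] =
  (foldr (@half_op C n) ((\det pencil_poly) ^+ 2) (enum 'I_n)).@[fun=> 0].
Proof.
have -> : (p_empty tau v).[x] = (map_mpoly (horner_eval x)
   (foldr (@op_i C n) (detsq tau v) (enum 'I_n))).@[fun=> 0].
  rewrite /p_empty -[LHS]/(horner_eval x _) -meval_map.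
  by apply: meval_eq => k; rewrite /= /horner_eval horner0.
congr (_.@[_]); elim: (enum _) => [|i r IH] /=; first exact: map_detsq.
by rewrite map_op_i IH.
Qed.

Lemma meval_det w : (\det pencil_poly).@[w] = \det (pencil w).
Proof.
rewrite -det_map_mx; congr (\det _); apply/matrixP => a b.
rewrite !mxE rmorphD /= mevalC summxE raddf_sum /= mulr_natr; congr (_ + _).
by apply: eq_bigr => i _; rewrite !mxE mevalM mevalXU mevalC mulrA.
Qed.

Lemma outerE (u : 'cV[C]_d) a b : outer u a b = u a 0 * (u b 0)^*.
Proof. by rewrite mxE big_ord1 !mxE. Qed.

(** The variable [z_i] multiplies a rank-one matrix, so the determinant is affine in it. *)
Lemma mderiv2_det i : mderiv i (mderiv i (\det pencil_poly)) = 0.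
Proof.
pose M : 'M[{mpoly C[n]}]_d := \matrix_(a, b) ((x * (a == b)%:R)%:MP +
    \sum_(k < n | k != i) 'X_k * (tau k * outer (v k) a b)%:MP).
pose u : 'cV[{mpoly C[n]}]_d := \col_a (tau i * v i a 0)%:MP.
pose r : 'rV[{mpoly C[n]}]_d := \row_b ((v i b 0)^*)%:MP.
have -> : pencil_poly = M + 'X_i *: (u *m r).
  apply/matrixP => a b; rewrite !mxE big_ord1 !mxE (bigD1 i) //=.
  rewrite -!addrA; congr (_ + _); rewrite addrC; congr (_ + _).
  by rewrite outerE mulrA mpolyCM.
have M0 a b : mderiv i (M a b) = 0.
  rewrite mxE mderivD mderivC add0r raddf_sum big1 //= => k ki.
  rewrite mderivM mderivC mulr0 addr0 mderivX mnm1E (negPf ki).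
  by rewrite scale0r mul0r.
have K0 : mderiv i (\det (block_mx M (- u) r 0)) = 0.
  apply: mderiv_det0 => a b; rewrite !mxE.
  case: splitP => a' _; rewrite !mxE; case: splitP => b' _; rewrite ?M0 // !mxE.
  - by rewrite mderivN mderivC oppr0.
  - by rewrite mderivC.
  - by rewrite mderiv0.
rewrite det_rank_one mderivD mderivM K0 mulr0 addr0 mderiv_det0 // add0r.
rewrite mderivM K0 mulr0 addr0 mderivX mnm1E eqxx scale1r.
have -> : (U_(i) - U_(i))%MM = 0%MM :> 'X_{1..n}.
  by apply/mnmP => k; rewrite mnmBE subnn mnm0E.
by rewrite mpolyX0 -mpolyC1 mderivC mul0r.
Qed.

(** The coefficient matrices are Hermitian: conjugation transposes the pencil, and the determinant
    ignores transposition. *)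
Lemma conj_det : conj_real (\det pencil_poly).
Proof.
rewrite /conj_real -det_map_mx -[RHS]det_tr; congr (\det _).
apply/matrixP => a b; rewrite !mxE rmorphD rmorph_sum /= map_mpolyC /=.
rewrite rmorphM /= rmorph_nat conj_Creal // eq_sym; congr (_ + _).
apply: eq_bigr => i _; rewrite rmorphM /= map_mpolyX map_mpolyC /= !outerE.
by rewrite !rmorphM /= conjCK conj_Creal ?gtr0_real // [X in _ * (_ * X)]mulrC.
Qed.

Lemma pencil_form w y : (y *m pencil w *m adjmx y) 0 0 =
  x * sqnorm y + \sum_i w i * tau i * `|pairing y (v i)| ^+ 2.
Proof.
rewrite mulmxDr mulmxDl mxE mul_mx_scalar -scalemxAl mxE; congr (_ + _).
rewrite mulmx_sumr mulmx_suml summxE; apply: eq_bigr => i _.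
by rewrite -scalemxAr -scalemxAl mxE outer_form.
Qed.

(** For a null vector [y], the imaginary part of the form is a sum of nonnegative terms equal to 0;
    every pairing with [v i] vanishes, leaving [x |y|^2 = 0]. *)
Lemma stable_det : stable (\det pencil_poly).
Proof.
move=> w Hw; rewrite meval_det; apply/det0P => -[y y0 E].
have := congr1 (fun z => 'Im z) (pencil_form w y).
have x0 : 0 < x by apply: lt_trans x3.
rewrite /= E mul0mx mxE raddf0 raddfD /= (Creal_ImP _ _) ?add0r; last first.
  by rewrite rpredM // ger0_real // sqnorm_ge0.
rewrite raddf_sum /=.
have term i : 'Im (w i * tau i * `|pairing y (v i)| ^+ 2) =
    'Im (w i) * (tau i * `|pairing y (v i)| ^+ 2).
  by rewrite -mulrA ImMr // rpredM ?rpredX ?normr_real ?gtr0_real.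
under eq_bigr do rewrite term.
have term0 i : 0 <= tau i * `|pairing y (v i)| ^+ 2.
  by rewrite mulr_ge0 ?exprn_ge0 // ltW.
move=> /esym /psumr_eq0P => H.
have {}H i : tau i * `|pairing y (v i)| ^+ 2 = 0.
  have /eqP : 'Im (w i) * (tau i * `|pairing y (v i)| ^+ 2) = 0.
    by apply: H => // k _; rewrite mulr_ge0 // ltW.
  by rewrite mulf_eq0 gt_eqF //= => /eqP.
have := pencil_form w y; rewrite E mul0mx mxE big1 => [|i _].
  by move/eqP; rewrite addr0 eq_sym mulf_eq0 !gt_eqF // sqnorm_gt0.
by rewrite -mulrA H mulr0.
Qed.

Hypothesis hsum : loewner_le
  (\sum_(i < n) (tau i ^+ 2) *: (outer (v i) *m outer (v i))) 1%:M.

(** The Loewner hypothesis tested on [adjmx y], with each [A_i^2] replaced by [weight i * A_i]. *)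
Lemma weight_form y : \sum_i weight i * tau i * `|pairing y (v i)| ^+ 2 <= sqnorm y.
Proof.
have := hsum (adjmx y); rewrite adjmxK mulmxBr mulmxBl mulmx1 mxE [X in _ + X]mxE.
rewrite subr_ge0; apply: le_trans; rewrite le_eqVlt; apply/orP; left; apply/eqP.
rewrite mulmx_sumr mulmx_suml summxE; apply: eq_bigr => i _.
by rewrite outer_sq scalerA -scalemxAr -scalemxAl mxE outer_form /weight; ring.
Qed.

Lemma weight_ge0 i : 0 <= weight i.
Proof. by rewrite mulr_ge0 ?sqnorm_ge0 // ltW. Qed.

Lemma pencil_form_ge w y : (forall k, - weight k <= w k) ->
  (x - 1) * sqnorm y <= (y *m pencil w *m adjmx y) 0 0.
Proof.
move=> Hw; rewrite pencil_form mulrBl mul1r lerD2l lerNl.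
apply: le_trans (weight_form y); rewrite -sumrN; apply: ler_sum => i _.
by rewrite -2!mulNr ler_wpM2r ?exprn_ge0 // ler_wpM2r ?(ltW (htau _)) // lerNl.
Qed.

Lemma det_neq0 w : (forall k, - weight k <= w k) -> (\det pencil_poly).@[w] != 0.
Proof.
move=> Hw; rewrite meval_det; apply/det0P => -[y y0 E].
have := pencil_form_ge y Hw; rewrite E mul0mx mxE.
have s0 : 0 < x - 1 by rewrite subr_gt0 (lt_trans _ x3) // ltr1n.
by rewrite lt_geF // mulr_gt0 // sqnorm_gt0.
Qed.

(* Otherwise moving [z_i] by [- det / d_i det] makes the pencil singular although its
   quadratic form stays positive definite, by Cauchy-Schwarz. *)
Lemma det_deriv_le w i : (forall k, - weight k <= w k) ->
  (x - 1) * ((mderiv i (\det pencil_poly)).@[w] * (\det pencil_poly).@[w]) <=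
  weight i * (\det pencil_poly).@[w] ^+ 2.
Proof.
move=> Hw; set p := _.@[w]; set b := (\det _).@[w].
have wr k : w k \is Num.real.
  by rewrite -(ler_real (Hw k)) rpredN ger0_real // weight_ge0.
have br : b \is Num.real by apply: meval_real conj_det _.
have pr : p \is Num.real by apply: meval_real => //; apply/conj_real_deriv/conj_det.
have s0 : 0 < x - 1 by rewrite subr_gt0 (lt_trans _ x3) // ltr1n.
have sr : x - 1 \is Num.real by rewrite gtr0_real.
have mr : weight i \is Num.real by rewrite ger0_real // weight_ge0.
rewrite (real_leNgt (rpredM sr (rpredM pr br)) (rpredM mr (rpredX 2 br))).
apply/negP => lt_bp.
have pb0 : 0 < p * b.
  rewrite -(pmulr_rgt0 _ s0); apply: le_lt_trans lt_bp.
  by rewrite mulr_ge0 ?weight_ge0 // real_exprn_even_ge0.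
have p0 : p != 0 by apply: contraTneq pb0 => ->; rewrite mul0r ltxx.
pose r := b / p.
have r0 : 0 < r.
  (* The affine restriction vanishes at step [- r]; a common sign of [p] and [b] places this zero on
     the negative side. *)
  have -> : r = p * b / p ^+ 2 by rewrite /r; field.
  by rewrite divr_gt0 // real_exprn_even_gt0.
pose w' k := w k + unit_dir C i k * - r.
have : (\det pencil_poly).@[w'] = 0.
  rewrite mevalD_unit_dir ?mderiv2_det ?mderiv0 // meval0 mulr0 mul0r addr0 -/p -/b.
  by rewrite /r; field.
rewrite meval_det => /eqP/det0P[y y0 E].
have := pencil_form w' y; rewrite E mul0mx mxE.
have -> : \sum_k w' k * tau k * `|pairing y (v k)| ^+ 2 =
  \sum_k w k * tau k * `|pairing y (v k)| ^+ 2 - r * (tau i * `|pairing y (v i)| ^+ 2).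
  under eq_bigr do rewrite /w' mulrDl mulrDl.
  rewrite big_split /=; congr (_ + _); rewrite (bigD1 i) //= big1 => [|k /negPf ki].
    by rewrite /unit_dir eqxx mul1r addr0 -mulrA mulNr.
  by rewrite /unit_dir ki !mul0r.
rewrite addrA -pencil_form => /esym/eqP; rewrite subr_eq0 => /eqP E2.
have N0 := sqnorm_gt0 y0.
have : (x - 1) * sqnorm y <= r * (weight i * sqnorm y).
  apply: le_trans (pencil_form_ge y Hw) _; rewrite E2 ler_pM2l //.
  by rewrite /weight -mulrA ler_pM2l // coef_le.
rewrite mulrA ler_pM2r // => le_r.
have : (x - 1) * (p * b) <= r * weight i * (p * b) by rewrite ler_pM2r.
have -> : r * weight i * (p * b) = weight i * b ^+ 2 by rewrite /r; field.
by move/(lt_le_trans lt_bp); rewrite ltxx.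
Qed.

(** The square of a determinant affine in each variable is quadratic in each, and its derivative
    [2 det d_j det] turns [det_deriv_le] into the bound with factor 2. *)
Lemma barrier_init : barrier (x - 1) weight [::] (\det pencil_poly ^+ 2).
Proof.
have cP := conj_det; have sP := stable_det.
split.
- by move=> w Hw; rewrite rmorphXn expf_neq0 // sP.
- by rewrite /conj_real rmorphXn /= cP.
- move=> i; rewrite expr2 !(mderivM, mderivD) !mderiv2_det.
  by rewrite !(mderiv0, mul0r, mulr0, addr0).
- move=> w Hw; rewrite rmorphXn real_exprn_even_gt0 ?det_neq0 //.
  by apply: meval_real => //; apply: above_real weight_ge0 _ _ Hw.
- move=> w j Hw _; rewrite expr2 mderivM mevalD !mevalM.
  have := det_deriv_le j Hw.
  rewrite -(ler_pM2l (_ : 0 < 2)) ?ltr0n // => H; apply: le_trans (le_trans H _).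
    by rewrite le_eqVlt; apply/orP; left; apply/eqP; ring.
  by rewrite le_eqVlt; apply/orP; left; apply/eqP; ring.
Qed.

Lemma p_empty_gt0 : 0 < (p_empty tau v).[x].
Proof.
have s2 : 2 < x - 1 by rewrite ltrBrDr natr1.
rewrite horner_p_empty.
suff [_ _ _ H _] : barrier (x - 1) weight (enum 'I_n)
    (foldr (@half_op C n) ((\det pencil_poly) ^+ 2) (enum 'I_n)).
  (* With every variable processed, the orthant is [z >= 0] and contains the origin. *)
  by apply: H => k; rewrite mem_enum.
elim: (enum _) (enum_uniq 'I_n) => [_|i r IH /andP[ir /IH H]] /=.
  exact: barrier_init.
exact: (barrier_half_op s2 weight_ge0 ir H).
Qed.
End Determinant.

Unset Implicit Arguments.

Theorem theorem4p1 (C : numClosedFieldType) (d n : nat)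
  (v : 'I_n -> 'cV[C]_d) (tau : 'I_n -> C)
  (htau : forall i, 0 < tau i)
  (hsum : loewner_le (\sum_(i < n) (tau i ^+ 2) *: (outer (v i) *m outer (v i)))
                     1%:M) :
  forall x : C, x \is Num.real -> root (p_empty tau v) x -> x <= 3.
Proof.
move=> x xr /rootP x0; rewrite real_leNgt ?realn //; apply/negP => x3.
by have := p_empty_gt0 htau xr x3 hsum; rewrite x0 ltxx.
Qed.
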